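(* Let $\Gamma=(P,\mathcal{L})$ be a point-line geometry satisfying the Exchange Property (EP). Then $\mathrm{rk}(\Gamma)=\mathrm{rk}_{\mathrm{WO}}(\Gamma)$.
   Context: A point-line geometry is a pair $\Gamma=(P,\mathcal{L})$ where $P$ (points) is a non-empty set and $\mathcal{L}$ (lines) is a family of subsets of $P$, each containing at least two points. A subspace of $\Gamma$ is a subset $S\subseteq P$ such that every line meeting $S$ in at least two points is contained in $S$ (so $\emptyset$ and $P$ are subspaces). For $X\subseteq P$, $\langle X\rangle$ is the smallest subspace containing $X$. Exchange Property (EP): for all $X\subseteq P$ and $x,y\in P$, if $y\in\langle X\cup\{x\}\rangle$ but $y\notin\langle X\rangle$, then $x\in\langle X\cup\{y\}\rangle$. The generating rank is $\mathrm{rk}_{\mathrm{gen}}(\Gamma):=\min\{|X| : X\subseteq P,\ \langle X\rangle=P\}$. When (EP) holds, it is called the rank of $\Gamma$ and denoted $\mathrm{rk}(\Gamma)$; in this case it equals the cardinality of any minimal generating set. A chain of subspaces is a (non-empty) set $\mathcal{C}$ of subspaces totally ordered by inclusion; its length is $\ell(\mathcal{C}):=|\mathcal{C}|-1$, with $|\mathcal{C}|-1=|\mathcal{C}|$ if $|\mathcal{C}|$ is infinite. $\mathfrak{W}(\Gamma)$ is the family of all chains of subspaces of $\Gamma$ that are well ordered by inclusion, and $\mathrm{rk}_{\mathrm{WO}}(\Gamma):=\sup\{\ell(\mathcal{C}) : \mathcal{C}\in\mathfrak{W}(\Gamma)\}$ (supremum of cardinals). *)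

(* Defs.v *)
From mathcomp Require Import all_boot.
From mathcomp Require Import finmap boolp classical_sets functions cardinality.

Set Implicit Arguments.
Unset Strict Implicit.
Unset Printing Implicit Defensive.

Local Open Scope classical_set_scope.
Local Open Scope card_scope.

(* A cardinal is represented by any set having it as cardinality: [A #= B] and
   [A #<= B] are equality and comparison of the cardinals |A| and |B|, also for
   sets over different types. *)

Definition is_card_min (T : Type) (F : set (set T)) (K : set T) : Prop :=
  F K /\ forall A, F A -> K #<= A.

(* The competing upper bounds M range over all cardinals, not only over those
   of subsets of T. *)
Definition is_card_sup (T : Type) (F : set (set T)) (K : set T) : Prop :=
  (forall A, F A -> A #<= K) /\
  (forall (U : Type) (M : set U), (forall A, F A -> A #<= M) -> K #<= M).

(* The default value set0 is never used: see card_minP and card_supP. *)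
Definition card_min (T : Type) (F : set (set T)) : set T :=
  xget set0 (is_card_min F).

Definition card_sup (T : Type) (F : set (set T)) : set T :=
  xget set0 (is_card_sup F).

(* Any family of cardinals has a least member: a maximal set of choice
   functions that are pairwise distinct at every index has its cardinality. *)
Lemma card_family_min (I : Type) (i0 : I) (T : I -> Type)
    (D : forall i, set (T i)) :
  exists i, forall j, D i #<= D j.
Proof.
pose good (F : set (forall i, T i)) :=
  (forall f, F f -> forall i, D i (f i)) /\
  (forall f g i, F f -> F g -> f i = g i -> f = g).
have [|F [[FD Finj] Fmax]] := @Zorn_bigcup (forall i, T i) good.
  move=> C Cgood Ctot; split=> [f [X CX Xf]|f g i [X CX Xf] [Y CY Yg]].
    by have [+ _] := Cgood _ CX; apply.
  case: (Ctot _ _ CX CY) => [XY|YX].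
    by have [_ +] := Cgood _ CY; apply=> //; exact: XY.
  by have [_ +] := Cgood _ CX; apply=> //; exact: YX.
have Fimg i : [set f i | f in F] #= F.
  by apply: inj_card_eq => f g /set_mem Ff /set_mem Fg; exact: Finj.
have [[i Di]|nsurj] := pselect (exists i, D i `<=` [set f i | f in F]).
  exists i => j; apply: card_le_trans (subset_card_le Di) _.
  rewrite (card_le_eql (Fimg i)) -(card_le_eql (Fimg j)).
  by apply: subset_card_le => _ [f Ff <-]; exact: FD.
have ex i : exists x, D i x /\ ~ [set f i | f in F] x.
  apply: contrapT => nex; apply: nsurj; exists i => x Dx.
  by apply: contrapT => nFx; apply: nex; exists x.
pose h i := projT1 (cid (ex i)).
have hD i : D i (h i) by rewrite /h; case: cid => x [].
have hF i : ~ [set f i | f in F] (h i) by rewrite /h; case: cid => x [].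
exfalso; apply: (Fmax (F `|` [set h])).
  split; first by move=> f Ff; left.
  move=> hsub; apply: (hF i0).
  by exists h => //; apply: hsub; right.
split=> [f [Ff|->] i|f g i]; [exact: FD|exact: hD|].
move=> [Ff|->] [Fg|->] // e.
- exact: Finj e.
- by case: (hF i); exists f.
- by case: (hF i); exists g.
Qed.

Lemma card_minP (T : Type) (F : set (set T)) :
  F !=set0 -> is_card_min F (card_min F).
Proof.
move=> [A0 FA0]; apply: xgetPex.
have [[A FA] Amin] :=
  @card_family_min {A | F A} (exist _ A0 FA0) (fun=> T) (fun A => sval A).
by exists A; split=> // B FB; exact: (Amin (exist _ B FB)).
Qed.

Lemma card_supP (T : Type) (F : set (set T)) : is_card_sup F (card_sup F).
Proof.
apply: xgetPex.
have [|K0 K0min] := @card_minP T [set K | forall A, F A -> A #<= K].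
  by exists setT => A _; exact: card_leT.
move: (card_min _) K0 K0min => K Kub Kmin.
exists K; split=> // U M Mub.
have [[] KM] := @card_family_min bool true (fun b => if b then T else U)
  (fun b => if b return set (if b then T else U) then K else M).
  exact: (KM false).
have /card_leP[f] : M #<= K := KM true.
have fM : [set val (f y) | y in [set: M]] #= M.
  apply: card_eq_trans (card_setT M).
  by apply: inj_card_eq => x y _ _ /val_inj; apply: inj; rewrite inE.
rewrite -(card_le_eqr fM); apply: Kmin => A FA.
by rewrite (card_le_eqr fM); exact: Mub.
Qed.

Record geometry (P : Type) := Geometry {
  line : set (set P);
  points_nonempty : [set: P] !=set0;
  line_two_points : forall l, line l -> exists x y, [/\ l x, l y & x <> y]
}.

Section PointLineGeometry.
Variables (P : Type) (G : geometry P).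

Definition subspace (S : set P) : Prop :=
  forall l, line G l ->
    (exists x y, [/\ (l `&` S) x, (l `&` S) y & x <> y]) -> l `<=` S.

Definition span (X : set P) : set P := smallest subspace X.

Lemma subspace_span (X : set P) : subspace (span X).
Proof.
move=> l Gl [x [y [[lx Xx] [ly Xy] xy]]] z lz S [Ssub XS].
apply: (Ssub l Gl) lz; exists x, y.
by split=> //; split=> //; [apply: Xx | apply: Xy].
Qed.

Definition exchange_property : Prop :=
  forall (X : set P) (x y : P),
    span (X `|` [set x]) y -> ~ span X y -> span (X `|` [set y]) x.

Definition generating : set (set P) := [set X | span X = setT].

(* Written rk, and called the rank, when the exchange property holds. *)
Definition rk_gen : set P := card_min generating.

Lemma rk_genP : is_card_min generating rk_gen.
Proof.
by apply: card_minP; exists setT; apply/seteqP; split=> // x _ S [_]; apply.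
Qed.

Definition subspace_chain (C : set (set P)) : Prop :=
  [/\ C !=set0, C `<=` subspace & total_on C subset].

Definition wo_chains : set (set (set P)) :=
  [set C | subspace_chain C /\
    forall D, D `<=` C -> D !=set0 ->
      exists2 S, D S & forall S', D S' -> S `<=` S'].

(* For finite C, |C| - 1 is represented by C with one element removed; an
   infinite C has |C| - 1 = |C|. *)
Definition chain_length (C : set (set P)) : set (set P) :=
  if `[< finite_set C >] then C `\ xget set0 C else C.

Lemma chain_length_finite (C : set (set P)) n :
  C #= `I_n.+1 -> chain_length C #= `I_n.
Proof.
move=> Cn; have Cfin : finite_set C by apply/finite_setP; exists n.+1.
have C0 : C !=set0.
  by apply/set0P; apply: contraTneq Cn => ->; rewrite card_eq_sym card_eq0;
    apply/eqP => /seteqP[/(_ 0%N)+ _]; apply.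
rewrite /chain_length asboolT //; have CS : C (xget set0 C) := xgetPex set0 C0.
move: (xget _ _) CS => S CS.
have finD : finite_set (C `\ S) by exact: finite_setD.
have /eqP := card_fset_set Cn.
rewrite (cardfsD1 S) in_fset_set // mem_set // add1n eqSS -fset_setD1 // => /eqP.
by move/card_eq_fsetP; rewrite fset_setK.
Qed.

Lemma chain_length_infinite (C : set (set P)) :
  infinite_set C -> chain_length C = C.
Proof. by move=> Cinf; rewrite /chain_length asboolF. Qed.

Definition rk_WO : set (set P) :=
  card_sup [set chain_length C | C in wo_chains].

Lemma rk_WOP : is_card_sup [set chain_length C | C in wo_chains] rk_WO.
Proof. exact: card_supP. Qed.

End PointLineGeometry.

(* Main.v *)
(* Closing a set of points only ever uses two points at a time, so span is
   finitary and, with the exchange property, behaves as in a matroid: chain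
   unions of independent sets are independent, and an independent set is no
   larger than a generating one. A well-ordered chain of subspaces yields an
   independent set, by picking one new point at each successor step; conversely
   a well-ordering of a smallest generating set yields a chain of the same
   size, made of the spans of the initial segments. *)
Require Import Defs.
From mathcomp Require Import all_boot.
From mathcomp Require Import finmap boolp classical_sets functions cardinality.
From mathcomp Require wochoice.

Set Implicit Arguments.
Unset Strict Implicit.
Unset Printing Implicit Defensive.

Local Open Scope classical_set_scope.
Local Open Scope card_scope.

(** * Cardinality after removing one element *)

Lemma card_setD1_eq (T : Type) (C : set T) (a b : T) :
  C a -> C b -> C `\ a #= C `\ b.
Proof.
move=> Ca Cb; have [->//|ab] := pselect (a = b).
(* Sending [b] to [a] and fixing all else maps one complement onto the other. *)
pose g x : T := if `[< x = b >] then a else x.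
have <- : g @` (C `\ a) = C `\ b.
  apply/seteqP; split=> [_ [x [Cx xa] <-]|x [Cx xb]].
    by rewrite /g; case: asboolP => // xb; split=> // ->.
  have [->|xa] := pselect (x = a).
    by exists b; [split=> // /esym | rewrite /g asboolT].
  by exists x; [split | rewrite /g asboolF].
rewrite card_eq_sym; apply: inj_card_eq => x y /set_mem[_ xa] /set_mem[_ ya].
rewrite /g; case: asboolP => [->|_]; case: asboolP => [->|_] // e.
by case: ya.
Qed.

(** Shifting along a copy [g] of the natural numbers inside [C] frees the point [g 0]; by
    [card_setD1_eq] any other point can be freed instead. *)
Lemma card_setD1_infinite (T : Type) (C : set T) (a : T) :
  infinite_set C -> C a -> C #= C `\ a.
Proof.
move=> /infiniteP/card_leP[f] Ca; pose g n : T := val (f (to_setT n)).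
have gC n : C (g n) by rewrite /g; case: (f _) => y Cy; exact: set_mem.
have g_inj : injective g.
  by move=> m n /val_inj/inj; rewrite !inE => /(_ I I)[].
suff C_le : C #<= C `\ g 0%N.
  rewrite card_eq_le [X in _ && X]subset_card_le ?andbT; last exact: subDsetl.
  by rewrite -(card_le_eqr (card_setD1_eq (gC 0%N) Ca)).
have step x : exists y, (forall n, x = g n -> y = g n.+1) /\
                        ((forall n, x <> g n) -> y = x).
  have [[n ->]|xg] := pselect (exists n, x = g n).
    by exists (g n.+1); split=> [m /g_inj->|/(_ n)].
  by exists x; split=> // n xn; case: xg; exists n.
have [h hP] := choice step.
have hg n : h (g n) = g n.+1 by have [+ _] := hP (g n); apply.
have hF x : (forall n, x <> g n) -> h x = x by have [_] := hP x.
have h_inj : injective h.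
  move=> x y.
  have [[m ->]|xg] := pselect (exists m, x = g m);
  have [[n ->]|yg] := pselect (exists n, y = g n).
  - by rewrite !hg => /g_inj[->].
  - by rewrite hg hF => [e|n yn]; case: yg; [exists m.+1|exists n].
  - by rewrite hg hF => [e|m xm]; case: xg; [exists n.+1|exists m].
  - by rewrite !hF // => [n yn|m xm]; [case: yg; exists n|case: xg; exists m].
rewrite -(card_le_eql (inj_card_eq (in2W h_inj))).
apply: subset_card_le => _ [x Cx <-].
have [[n ->]|xg] := pselect (exists n, x = g n).
  by rewrite hg; split=> // /g_inj.
rewrite hF => [|n xn]; last by case: xg; exists n.
by split=> // x0; case: xg; exists 0%N.
Qed.

(** Lets each later bound remove the member that suits it, instead of the one chosen by [xget]. *)
Lemma card_chain_length (P : Type) (C : set (set P)) (S : set P) :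
  C S -> chain_length C #= C `\ S.
Proof.
move=> CS; have [Cfin|Cinf] := pselect (finite_set C).
  rewrite /chain_length asboolT //; apply: card_setD1_eq => //.
  by apply: (@xgetPex _ set0 C); exists S.
by rewrite chain_length_infinite //; apply: card_setD1_infinite.
Qed.

(** * Well-orderings *)

Lemma well_ordering_Prop (T : Type) : exists2 R : T -> T -> Prop,
  (forall x y, R x y -> R y x -> x = y) &
  forall A : set T, A !=set0 -> exists2 m, A m & forall x, A x -> R m x.
Proof.
have [R Rwo] := wochoice.well_ordering_principle {classic T}.
have Rmin (A : set T) : A !=set0 ->
    exists2 m, A m & forall x, A x -> R m x.
  move=> [x Ax]; have [|m [[/asboolP Am mle] _]] := Rwo (fun x => `[< A x >]).
    by exists x; exact/asboolP.
  by exists m => // y Ay; apply: mle; exact/asboolP.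
exists R => // x y xy yx.
have xx : R x x by have [|m -> ] := Rmin [set x]; [exists x|exact].
have yy : R y y by have [|m -> ] := Rmin [set y]; [exists y|exact].
(* Both [x] and [y] are least in the pair, and the least element is unique. *)
have [|m [_ mP]] := Rwo (fun z => `[< z = x \/ z = y >]).
  by exists x; apply/asboolP; left.
rewrite -(mP x) ?(mP y) //; split.
- by apply/asboolP; right.
- by move=> z /asboolP[]->.
- by apply/asboolP; left.
- by move=> z /asboolP[]->.
Qed.

(** * Spans and independent sets *)

Section Span.
Variables (P : Type) (G : geometry P).
Implicit Types (X Y S : set P) (x y : P).

Lemma sub_span X : X `<=` span G X.
Proof. exact: sub_gen_smallest. Qed.

Lemma span_sub X S : subspace G S -> X `<=` S -> span G X `<=` S.
Proof. exact: smallest_sub. Qed.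

Lemma span_mono X Y : X `<=` Y -> span G X `<=` span G Y.
Proof.
move=> XY; apply: (span_sub (@subspace_span P G Y)).
exact: subset_trans XY (@sub_span Y).
Qed.

(* A subspace is only tested on pairs of points, so unions of chains of
   subspaces are subspaces. *)
Lemma subspace_bigcup (I : Type) (D : set I) (S : I -> set P) :
  (forall i, D i -> subspace G (S i)) ->
  (forall i j, D i -> D j -> S i `<=` S j \/ S j `<=` S i) ->
  subspace G (\bigcup_(i in D) S i).
Proof.
move=> Ssub Stot l Gl [x [y [[lx [i Di Sx]] [ly [j Dj Sy]] xy]]] z lz.
case: (Stot i j Di Dj) => [ij|ji].
  exists j => //; apply: (Ssub j Dj l Gl) lz; exists x, y.
  by split=> //; split=> //; exact: ij.
exists i => //; apply: (Ssub i Di l Gl) lz; exists x, y.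
by split=> //; split=> //; exact: ji.
Qed.

Definition independent X := forall x, X x -> ~ span G (X `\ x) x.

Lemma independent_sub X Y : X `<=` Y -> independent Y -> independent X.
Proof.
move=> XY Yi x Xx; apply: contra_not (Yi x (XY x Xx)).
by apply: span_mono; exact: setSD.
Qed.

Lemma independent_bigcup (I : Type) (D : set I) (X : I -> set P) :
  (forall i, D i -> independent (X i)) ->
  (forall i j, D i -> D j -> X i `<=` X j \/ X j `<=` X i) ->
  independent (\bigcup_(i in D) X i).
Proof.
move=> Xi Xtot x [i Di Xix] xspan.
(* The spans form a chain, so their union is a subspace; hence a dependence of [x] on the whole
   union already occurs in a single [X j]. *)
have : (\bigcup_(j in D) span G (X j `\ x)) x.
  apply: (span_sub _ _ xspan).
    apply: subspace_bigcup => [j _|j k Dj Dk]; first exact: subspace_span.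
    by case: (Xtot j k Dj Dk) => ?; [left|right];
      apply: span_mono; exact: setSD.
  by move=> y [[j Dj Xy] yx]; exists j => //; apply: sub_span.
move=> [j Dj xj]; case: (Xtot i j Di Dj) => [ij|ji].
  exact: Xi j Dj x (ij x Xix) xj.
by apply: (Xi i Di x Xix); apply: span_mono xj; exact: setSD.
Qed.

(** * Consequences of the exchange property *)

Hypothesis EP : exchange_property G.

(** If some [x] in [X] became dependent, exchanging it with [y] would put [y] in the span of [X]. *)
Lemma independent_setU1 X y :
  independent X -> ~ span G X y -> independent (X `|` [set y]).
Proof.
move=> Xi Xy x [Xx|->].
  have yx : y <> x by move=> yx; apply: Xy; rewrite yx; exact: sub_span.
  have -> : (X `|` [set y]) `\ x = (X `\ x) `|` [set y].
    apply/seteqP; split=> [z [[Xz|->] zx]|z [[Xz zx]|->]];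
      by [left|right|split=> //; left|split=> //; right].
  move=> xspan; apply: Xy; apply: span_mono (EP xspan (Xi x Xx)).
  by move=> z [[]|->].
apply: contra_not Xy; apply: span_mono.
by move=> z [[|zy] nzy].
Qed.

(* A maximal partial injection F from I to K such that exchanging its domain
   for its range keeps I independent is defined on all of I: if x is left over
   then x is not spanned by the rest, so the rest does not contain K in its
   span, and any missing point of K may be exchanged for x. *)
Lemma independent_card_le (I K : set P) :
  independent I -> generating G K -> I #<= K.
Proof.
move=> Ii genK.
pose exch (F : set (P * P)) := (I `\` fst @` F) `|` snd @` F.
(* By the third clause, no point of the range is a point of [I] still waiting to be exchanged. *)
pose good (F : set (P * P)) :=
  [/\ forall p, F p -> I p.1 /\ K p.2,
      forall p q, F p -> F q -> (p.1 = q.1) <-> (p.2 = q.2),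
      forall p, F p -> I p.2 -> (fst @` F) p.2 & independent (exch F)].
have [|F [[FIK Finj Fdisj Findep] Fmax]] := @Zorn_bigcup (P * P)%type good.
  move=> C Cgood Ctot.
  have [->|/set0P[F0 CF0]] := eqVneq C set0.
    rewrite bigcup_set0; split=> //.
    by apply: independent_sub Ii => x [[]|[]].
  (* [exch] is not monotone; removing the domain of the whole union from [I] gives sets that do form
     a chain, each inside the independent [exch F]. *)
  have exchC : exch (\bigcup_(F in C) F) =
      \bigcup_(F in C) ((I `\` fst @` \bigcup_(F in C) F) `|` snd @` F).
    apply/seteqP; split=> [x [Ix|[p [F CF Fp] <-]]|x [F CF [Ix|[p Fp <-]]]].
    - by exists F0 => //; left.
    - by exists F => //; right; exists p.
    - by left.
    - by right; exists p => //; exists F.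
  split.
  - by move=> p [F CF]; case: (Cgood F CF) => + _ _ _; apply.
  - move=> p q [F CF Fp] [H CH Hq]; case: (Ctot F H CF CH) => [FH|HF].
      by case: (Cgood H CH) => _ + _ _; apply=> //; exact: FH.
    by case: (Cgood F CF) => _ + _ _; apply=> //; exact: HF.
  - move=> p [F CF Fp] Ip; case: (Cgood F CF) => _ _ + _.
    by move=> /(_ p Fp Ip)[r Fr <-]; exists r => //; exists F.
  - rewrite exchC; apply: independent_bigcup => [F CF|F H CF CH].
      case: (Cgood F CF) => _ _ _; apply: independent_sub.
      apply: setSU => x [Ix xF]; split=> // -[p Fp px]; apply: xF.
      by exists p => //; exists F.
    by case: (Ctot F H CF CH) => FH; [left|right];
      apply: setUS; exact: image_subset.
have [Fdom|/nonsubset[x [Ix Fx]]] := pselect (I `<=` fst @` F).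
  apply: card_le_trans (subset_card_le Fdom) _.
  have inj1 : fst @` F #= F.
    apply: inj_card_eq => -[a b] [c d] /set_mem Fp /set_mem Fq /= ac.
    by have /(_ ac)/= -> := (Finj _ _ Fp Fq).1; rewrite ac.
  have inj2 : snd @` F #= F.
    apply: inj_card_eq => -[a b] [c d] /set_mem Fp /set_mem Fq /= bd.
    by have /(_ bd)/= -> := (Finj _ _ Fp Fq).2; rewrite bd.
  rewrite (card_le_eql inj1) -(card_le_eql inj2).
  by apply: subset_card_le => _ [p Fp <-]; have [] := FIK p Fp.
exfalso.
have exx : exch F x by left.
have [k [Kk knspan]] : exists k, K k /\ ~ span G (exch F `\ x) k.
  apply/nonsubset => Ksub; apply: (Findep x exx).
  have : span G K x by rewrite genK.
  exact: (span_sub (@subspace_span P G _) Ksub).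
have kF : ~ (snd @` F) k.
  move=> Fk; apply: knspan; apply: sub_span; split; first by right.
  by move=> kx; move: Fk Fx; rewrite kx => -[p Fp px]; rewrite -px in Ix *;
    case; exact: Fdisj Fp Ix.
apply: (Fmax (F `|` [set (x, k)])).
  split; first by move=> p; left.
  by move=> sub; apply: Fx; exists (x, k) => //; apply: sub; right.
split.
- by move=> p [/FIK//|->].
- move=> p q [Fp|->] [Fq|->] //=; first exact: Finj.
  + by split=> [px|pk]; [case: Fx; exists p|case: kF; exists p].
  + by split=> [px|pk]; [case: Fx; exists q|case: kF; exists q].
- move=> p [Fp|->] /= Ip.
    by have [r Fr rp] := Fdisj p Fp Ip; exists r => //; left.
  (* [k] may be [x] itself. A [k] in [I] other than [x] and outside the old domain would lie in
     [exch F] minus [x], against its choice. *)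
  have [->|kx] := pselect (k = x); first by exists (x, x) => //; right.
  have [[r Fr rp]|Fk] := pselect ((fst @` F) k).
    by exists r => //; left.
  by case: knspan; apply: sub_span; split=> //; left.
- have : independent (exch F `\ x `|` [set k]).
    by apply: independent_setU1 knspan; exact: independent_sub Findep.
  apply: independent_sub => y [[Iy yF]|[p [Fp|->] <-]]; last by right.
    left; split=> [|yx].
      by left; split=> // -[p Fp py]; apply: yF; exists p => //; left.
    by apply: yF; exists (x, k); [right|].
  left; split=> [|px]; first by right; exists p.
  by apply: Fx; rewrite -px; apply: Fdisj Fp _ => //; rewrite px.
Qed.

(** * From well-ordered chains to independent sets *)

(* Every non-maximal S in C has a successor in C; picking f S in the successor
   but not in S gives an independent set indexed by the non-maximal S. *)
Lemma wo_chain_independent (C : set (set P)) : wo_chains G C ->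
  exists I, independent I /\
    [set S | C S /\ exists2 S', C S' & ~ S' `<=` S] #<= I.
Proof.
move=> [[_ Csub Ctot] Cwo]; set N := [set S | _].
(* Outside [N] the point is arbitrary. *)
have pick S : exists x, N S ->
    ~ S x /\ forall S', C S' -> ~ S' `<=` S -> S' x.
  have [[CS [S1 CS1 S1S]]|nN] := pselect (N S); last first.
    by have [x _] := points_nonempty G; exists x.
  have [||S' [CS' S'S] S'min] := Cwo [set S' | C S' /\ ~ S' `<=` S].
  - by move=> ? [].
  - by exists S1.
  - move/nonsubset: (S'S) => [x [S'x Sx]]; exists x => _; split=> // S2 CS2 S2S.
    exact: (S'min S2).
have [f fP] := choice pick.
have fN S : N S -> ~ S (f S) by move=> /fP[].
have fS S S' : N S -> C S' -> ~ S' `<=` S -> S' (f S).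
  by move=> /fP[_ +]; apply.
pose J S := f @` [set S' | N S' /\ S' `<=` S].
have Jmono S S' : S `<=` S' -> J S `<=` J S'.
  move=> SS' _ [R [NR RS] <-]; exists R => //; split=> //.
  exact: subset_trans SS'.
have Jtot S S' : C S -> C S' -> J S `<=` J S' \/ J S' `<=` J S.
  by move=> CS CS'; case: (Ctot S S' CS CS') => /Jmono; [left|right].
have Jindep S : N S -> independent (J S).
  move=> NS; apply: contrapT => nJ.
  have [||S0 [NS0 nJ0] S0min] := Cwo [set S | N S /\ ~ independent (J S)].
  - by move=> ? [[]].
  - by exists S.
  apply: nJ0.
  (* [S0] is a least counterexample and [D] the part of [N] strictly below it: the points picked
     there lie in the subspace [S0], which misses [f S0]. *)
  pose D := [set S | N S /\ ~ S0 `<=` S].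
  have DJi : independent (\bigcup_(R in D) J R).
    apply: independent_bigcup => [R [NR S0R]|R R' [[CR _] _] [[CR' _] _]].
      by apply: contrapT => nJR; apply: S0R; exact: S0min.
    exact: Jtot.
  have DJS0 : \bigcup_(R in D) J R `<=` S0.
    move=> _ [R [NR S0R] [R' [NR' R'R] <-]].
    apply: fS => //; first exact: NS0.1.
    by move=> S0R'; apply: S0R; exact: subset_trans R'R.
  have nDJ : ~ span G (\bigcup_(R in D) J R) (f S0).
    by move=> /(span_sub (Csub _ NS0.1) DJS0); exact: fN.
  apply: independent_sub (independent_setU1 DJi nDJ) => _ [R [NR RS0] <-].
  have [S0R|S0R] := pselect (S0 `<=` R).
    by right; congr f; apply/seteqP; split.
  by left; exists R => //; exists R => //; split=> //; exact: subset_refl.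
exists (f @` N); split.
  have : independent (\bigcup_(S in N) J S).
    by apply: independent_bigcup => // S S' [CS _] [CS' _]; exact: Jtot.
  apply: independent_sub => _ [S NS <-]; exists S => //; exists S => //.
  by split=> //; exact: subset_refl.
have f_inj : {in N &, injective f}.
  move=> S S' /set_mem NS /set_mem NS' e.
  apply/seteqP; split; apply: contrapT => nSS'.
    by apply: (fN S NS); rewrite e; apply: fS NS' NS.1 nSS'.
  by apply: (fN S' NS'); rewrite -e; apply: fS NS NS'.1 nSS'.
by have := inj_card_eq f_inj; rewrite card_eq_le => /andP[].
Qed.

Lemma wo_chain_length_le (C : set (set P)) (K : set P) :
  wo_chains G C -> generating G K -> chain_length C #<= K.
Proof.
move=> Cwo genK; have [I [Ii NI]] := wo_chain_independent Cwo.
apply: card_le_trans (card_le_trans NI (independent_card_le Ii genK)).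
have [[[S0 CS0] _ Ctot] _] := Cwo.
(* [S] is the largest member if there is one, which the -1 in the length pays for; otherwise any
   member will do. *)
have [S [CS CSN]] : exists S, C S /\
    C `\ S `<=` [set S | C S /\ exists2 S', C S' & ~ S' `<=` S].
  have [[S [CS Smax]]|nmax] :=
      pselect (exists S, C S /\ C `<=` [set S' | S' `<=` S]).
    exists S; split=> // R [CR RS]; split=> //; exists S => // SR.
    by apply: RS; apply/seteqP; split=> //; exact: Smax.
  exists S0; split=> // R [CR _]; split=> //.
  apply: contrapT => nR; apply: nmax; exists R; split=> // S' CS'.
  by apply: contrapT => S'R; apply: nR; exists S'.
by rewrite (card_le_eql (card_chain_length CS)); exact: subset_card_le.
Qed.

End Span.

(** * From generating sets to well-ordered chains *)

(* Discard from a well-ordered K every point spanned by its predecessors: what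
   remains still generates, and its points are separated by the spans of the
   initial segments. The extra member setT of C makes up for the -1 in its
   length. *)
Lemma generating_wo_chain (P : Type) (G : geometry P) (K : set P) :
  generating G K -> exists B C,
    [/\ generating G B, wo_chains G C & B #<= chain_length C].
Proof.
move=> genK; have [R Ranti Rwo] := well_ordering_Prop P.
have Rtot x y : R x y \/ R y x.
  have [|_ [->|->] mP] := Rwo [set x; y]; first by exists x; left.
    by left; apply: mP; right.
  by right; apply: mP; left.
pose below k := [set k' | K k' /\ ~ R k k'].
have below_mono k k' : R k k' -> below k `<=` below k'.
  move=> kk' z [Kz kz]; split=> // k'z; apply: kz.
  (* The least element of the triple stands in for transitivity of [R]. *)
  have [|_ [[->|->]|->] mP] := Rwo [set k; k'; z].
  - by exists k; left; left.
  - by apply: mP; right.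
  - have <- : k' = k by apply: Ranti kk'; apply: mP; left; left.
    by apply: mP; right.
  - by have -> : z = k' by apply: Ranti k'z; apply: mP; left; right.
pose B := [set k | K k /\ ~ span G (below k) k].
pose C := [set span G (below k) | k in B] `|` [set setT].
have BC k k' : B k -> B k' -> span G (below k) = span G (below k') -> k = k'.
  move=> [Kk nk] [Kk' nk'] e.
  case: (pselect (R k k')) => [kk'|kk']; case: (pselect (R k' k)) => [k'k|k'k].
  - exact: Ranti.
  - by case: nk; rewrite e; apply: sub_span.
  - by case: nk'; rewrite -e; apply: sub_span.
  - by case: (Rtot k k').
exists B, C; split.
- suff KB : K `<=` span G B.
    apply/seteqP; split=> // x _; have : span G K x by rewrite genK.
    exact: (span_sub (@subspace_span P G B) KB).
  apply: contrapT => /nonsubset nKB.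
  (* All predecessors of the least [k] outside the span of [B] lie in that span, so [k] does too if
     it was discarded. *)
  have [//|k [Kk nk] kmin] := Rwo [set k | K k /\ ~ span G B k].
  apply: nk; have [kB|] := pselect (B k); first exact: sub_span.
  move=> /not_andP[//|/contrapT].
  apply: (span_sub (@subspace_span P G B)) => z [Kz kz].
  by apply: contrapT => nz; apply: kz; exact: kmin.
- split; first split.
  + by exists setT; right.
  + by move=> _ [[k Bk <-]|->]; [exact: subspace_span|move=> l].
  + move=> _ _ [[k Bk <-]|->] [[k' Bk' <-]|->]; try by [left|right].
    by case: (Rtot k k') => /below_mono; [left|right]; apply: span_mono.
  + move=> D DC [S DS].
    have [[k [Bk Dk]]|nk] := pselect (exists k, B k /\ D (span G (below k))).
      have [|m [Bm Dm] mmin] := Rwo [set k | B k /\ D (span G (below k))].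
        by exists k.
      exists (span G (below m)) => // S' DS'.
      case: (DC S' DS') => [[k' Bk' e]|->//]; rewrite -e; apply: span_mono.
      by apply: below_mono; apply: mmin; split=> //; rewrite e.
    exists S => // S' DS'; case: (DC S' DS') => [[k Bk e]|->//].
    by case: nk; exists k; rewrite e.
- have CT : C setT by right.
  rewrite (card_le_eqr (card_chain_length CT)).
  have /card_le_eql <- : [set span G (below k) | k in B] #= B.
    by apply: inj_card_eq => k k' /set_mem Bk /set_mem Bk'; exact: BC.
  apply: subset_card_le => _ [k Bk <-]; split; first by left; exists k.
  by move=> e; case: Bk => _; rewrite e; apply.
Qed.

Theorem theorem1p3 (P : Type) (G : geometry P) (EP : exchange_property G) :
  (rk_gen G #= rk_WO G)%card.
Proof.
have [rk_generates rk_le] := rk_genP G; have [WO_ub WO_lub] := rk_WOP G.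
rewrite card_eq_le; apply/andP; split.
  have [B [C [genB Cwo BC]]] := generating_wo_chain rk_generates.
  (* [B] may differ from the chosen generating set; minimality of [rk_gen] among all generating sets
     covers this. *)
  apply: card_le_trans (rk_le B genB) (card_le_trans BC _).
  by apply: WO_ub; exists C.
by apply: WO_lub => _ [C Cwo <-]; exact: (wo_chain_length_le EP).
Qed.
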